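(* Let $r<p$ and $s<q$ be positive integers and let $A$ be an invertible even supermatrix of size $p|q\times p|q$ over a commutative superalgebra. Let $u=(p-r+1,\dots,p\,|\,\hat q-\hat s+\hat 1,\dots,\hat q)$ and $v=(1,\dots,r\,|\,\hat 1,\dots,\hat s)$, and let $\tilde u=(1,\dots,p-r\,|\,\hat 1,\dots,\hat q-\hat s)$ and $\tilde v=(r+1,\dots,p\,|\,\hat s+\hat 1,\dots,\hat q)$ be their complements. If $A^u_v$ and $(A^{-1})^{\tilde v}_{\tilde u}$ are invertible, then $$\mathrm{Ber}(A)\;\mathrm{Ber}\big((A^{-1})^{\tilde v}_{\tilde u}\big)=(-1)^t\,\mathrm{Ber}(A^u_v),\qquad t=r(p+1)+s(q+1).$$
   Context: The ground field is $\mathbb R$ or $\mathbb C$. A commutative superalgebra is a $\mathbb Z_2$-graded associative unital algebra $\mathcal A=\mathcal A_0\oplus\mathcal A_1$ with $ab=(-1)^{p(a)p(b)}ba$ for homogeneous elements of parities $p(a),p(b)$. An even supermatrix of size $m|n\times m|n$ over $\mathcal A$ is a block matrix $B=\begin{pmatrix} B_1 & B_2 \\ B_3 & B_4 \end{pmatrix}$ with $B_1$ of size $m\times m$ and $B_4$ of size $n\times n$ with entries in $\mathcal A_0$, and $B_2,B_3$ with entries in $\mathcal A_1$; its first $m$ rows/columns are called even and are indexed by $1,\dots,m$, its last $n$ rows/columns are called odd and are indexed by $\hat1,\dots,\hat n$. If $B_4$ is invertible, the Berezinian is $\mathrm{Ber}\,B:=\det(B_4)^{-1}\det(B_1-B_2B_4^{-1}B_3)$.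 For sets of indices $a,b$ (each listing even indices, then odd indices after the bar), $C^{a}_{b}$ denotes the supermatrix obtained from $C$ by deleting the rows whose indices are in $a$ and the columns whose indices are in $b$. Thus $A^u_v$ is obtained from $A$ by deleting the last $r$ even rows, last $s$ odd rows, first $r$ even columns and first $s$ odd columns, and $(A^{-1})^{\tilde v}_{\tilde u}$ is the $r|s\times r|s$ supermatrix formed by the first $r$ even and first $s$ odd rows and the last $r$ even and last $s$ odd columns of $A^{-1}$. *)

(* Defs.v *)
From mathcomp Require Import all_boot all_order all_algebra.
From mathcomp Require Import all_classical all_reals.
From mathcomp Require Export complex.

Set Implicit Arguments.
Unset Strict Implicit.
Unset Printing Implicit Defensive.

Import GRing.Theory.
Local Open Scope ring_scope.

Inductive ground_field := RealGround | ComplexGround.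

Definition scalars (R : realType) (k : ground_field) : fieldType :=
  match k with RealGround => R | ComplexGround => R[i]%C end.

(* Parities are booleans, [true] being odd, and [(+)] is addition in Z/2. *)
Record comm_superalgebra (K : fieldType) (S : algType K)
    (part : bool -> {pred S}) : Prop := CommSuperalgebra {
  part_submod : forall a, submod_closed (part a);
  part_sum : forall x, exists x0 x1,
    [/\ x0 \in part false, x1 \in part true & x = x0 + x1];
  part_direct : forall x, x \in part false -> x \in part true -> x = 0;
  part_one : 1 \in part false;
  part_mul : forall a b x y,
    x \in part a -> y \in part b -> x * y \in part (a (+) b);
  part_comm : forall a b x y,
    x \in part a -> y \in part b -> x * y = (-1) ^+ (a && b) * (y * x)
}.

(* Two-sided inverses in a possibly noncommutative ring. They are used both
   for elements of the superalgebra and for square matrices over it, which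
   form a ring ['M[S]_n]; the library's [unitmx] and [invmx] are only available
   over commutative rings. *)
Definition is_inverse (T : pzRingType) (x y : T) : Prop :=
  x * y = 1 /\ y * x = 1.

Definition invertible (T : pzRingType) (x : T) : Prop :=
  exists y, is_inverse x y.

(* The unique inverse of [x] if [x] is invertible, and [0] otherwise. *)
Definition inverse (T : pzRingType) (x : T) : T := xget 0 (is_inverse x).

Definition even_supermatrix (K : fieldType) (S : algType K)
    (part : bool -> {pred S}) m n (B : 'M[S]_(m + n)) : Prop :=
  [/\ ulsubmx B \is a mxOver (part false),
      ursubmx B \is a mxOver (part true),
      dlsubmx B \is a mxOver (part true) &
      drsubmx B \is a mxOver (part false)].

(* For an even supermatrix both determinants are taken of matrices with entries
   in the commutative subring of even elements, so the order of the factors in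
   the Leibniz formula defining [\det] is immaterial. *)
Definition Ber (T : pzRingType) m n (B : 'M[T]_(m + n)) : T :=
  inverse (\det (drsubmx B)) *
  \det (ulsubmx B - ursubmx B *m inverse (drsubmx B) *m dlsubmx B).

(* The even indices of the set, and its odd indices. *)
Definition superindices (m n : nat) := ({set 'I_m} * {set 'I_n})%type.

(* Deleting [a] leaves [k] even and [l] odd indices. *)
Definition leaves m n (a : superindices m n) (k l : nat) : Prop :=
  #|~: a.1| = k /\ #|~: a.2| = l.

(* The [i]-th index not in [a], in increasing order. *)
Definition kept m k (a : {set 'I_m}) (ak : #|~: a| = k) (i : 'I_k) : 'I_m :=
  enum_val (cast_ord (esym ak) i).

(* Rows in [a] and columns in [b] are deleted; the proofs only fix the sizes of
   the remaining blocks. *)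
Definition superdel (T : Type) m n k l k' l' (a b : superindices m n)
    (ha : leaves a k l) (hb : leaves b k' l') (C : 'M[T]_(m + n)) :
    'M[T]_(k + l, k' + l') :=
  block_mx (mxsub (kept (proj1 ha)) (kept (proj1 hb)) (ulsubmx C))
           (mxsub (kept (proj1 ha)) (kept (proj2 hb)) (ursubmx C))
           (mxsub (kept (proj2 ha)) (kept (proj1 hb)) (dlsubmx C))
           (mxsub (kept (proj2 ha)) (kept (proj2 hb)) (drsubmx C)).

Definition first_indices m k : {set 'I_m} := [set i : 'I_m | (i < k)%N].
Definition last_indices m k : {set 'I_m} := [set i : 'I_m | (m - k <= i)%N].

Definition first_super m n k l : superindices m n := (first_indices m k, first_indices n l).
Definition last_super m n k l : superindices m n := (last_indices m k, last_indices n l).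

Lemma card_first_indices m k : (k <= m)%N -> #|first_indices m k| = k.
Proof.
move=> km.
have inj : injective (widen_ord km).
  by move=> i j /(congr1 val) /= /val_inj.
rewrite -[RHS]card_ord -cardsT -(card_imset _ inj); apply: eq_card => i.
rewrite inE; apply/idP/imsetP => [ik|[j _ ->]]; last exact: ltn_ord j.
by exists (Ordinal ik) => //; exact/val_inj.
Qed.

Lemma setC_last_indices m k : ~: last_indices m k = first_indices m (m - k).
Proof. by apply/finset.setP => i; rewrite !inE -ltnNge. Qed.

Lemma leaves_last m n k l : leaves (last_super m n k l) (m - k) (n - l).
Proof. by split; rewrite setC_last_indices card_first_indices ?leq_subr. Qed.

Lemma card_setC_first_indices m k : #|~: first_indices m k| = (m - k)%N.
Proof.
have [km|/ltnW mk] := leqP k m.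
  by rewrite cardsCs finset.setCK card_first_indices // card_ord.
have -> : first_indices m k = [set: 'I_m].
  by apply/setP => i; rewrite !inE (leq_trans _ mk).
by rewrite finset.setCT cards0; apply/esym/eqP; rewrite subn_eq0.
Qed.

Lemma leaves_first m n k l : leaves (first_super m n k l) (m - k) (n - l).
Proof. by split; rewrite card_setC_first_indices. Qed.

Lemma leaves_lastC m n k l : (k < m)%N -> (l < n)%N ->
  leaves (last_super m n (m - k) (n - l)) k l.
Proof.
by move=> /ltnW km /ltnW ln; have := leaves_last m n (m - k) (n - l);
  rewrite !subKn.
Qed.

Lemma leaves_firstC m n k l : (k < m)%N -> (l < n)%N ->
  leaves (first_super m n (m - k) (n - l)) k l.
Proof.
by move=> /ltnW km /ltnW ln; have := leaves_first m n (m - k) (n - l);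
  rewrite !subKn.
Qed.

(* Main.v *)
(* The Berezinian is multiplicative: writing [b = B2' B4'^-1] and
   [g = B4^-1 B3], the odd-odd block of [B B'] is [B4 (1 + g b) B4'] and its
   Schur complement is [(B1 - B2 g) (1 + b g)^-1 (B1' - b B3')], so everything
   rests on the identity [det (1 + b g) det (1 + g b) = 1] for odd matrices
   [b] and [g].

   For the theorem, rotate the columns of [A] by [r|s], and the rows of [A^-1]
   accordingly, at the cost of the sign [(-1)^t]. In block form, [A^u_v] is then
   the upper left block X of [A = (X Y; Z W)], [(A^-1)^v'_u'] is the lower right
   block F of [A^-1 = (G H; E F)], and
     [(X Y; Z W) (1 H; 0 F) = (X 0; Z 1)].
   Taking Berezinians gives the result. *)
From HB Require Import structures.
Require Import Defs.
From mathcomp Require Import all_boot all_order all_fingroup all_algebra.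
From mathcomp Require Import all_classical all_reals.

Set Implicit Arguments.
Unset Strict Implicit.
Unset Printing Implicit Defensive.

Import GRing.Theory.
Local Open Scope ring_scope.

(** * Determinants over a commuting subring *)

Section CommutingSubring.
Variables (S : nzRingType) (E : {pred S}).
Hypothesis E_ring : subring_closed E.
Hypothesis E_comm : {in E &, commutative (@GRing.mul S)}.

(* The two proofs are parameters of the type so that it can be given a canonical
   commutative ring structure, over which the library's determinant theory
   applies. *)
Definition commuting_subring of subring_closed E &
  {in E &, commutative (@GRing.mul S)} := {x : S | x \in E}.
Local Notation U := (commuting_subring E_ring E_comm).

HB.instance Definition _ := SubChoice.copy U {x : S | x \in E}.
HB.instance Definition _ := GRing.SubChoice_isSubNzRing.Build S E U E_ring.
Fact commuting_subring_mulC : commutative (@GRing.mul U).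
Proof. by move=> x y; apply: val_inj; rewrite !rmorphM; apply: E_comm; apply: valP. Qed.
HB.instance Definition _ :=
  GRing.PzSemiRing_hasCommutativeMul.Build U commuting_subring_mulC.

(** Matrices over [E] lift to the commutative ring [U]; determinant identities over [U] then come
    back along the ring morphism [val]. *)
Lemma mxOver_valP m n (M : 'M[S]_(m, n)) :
  M \is a mxOver E -> exists N : 'M[U]_(m, n), M = map_mx val N.
Proof.
move=> /mxOverP ME; exists (\matrix_(i, j) (Sub (M i j) (ME i j) : U)).
by apply/matrixP => i j; rewrite !mxE SubK.
Qed.

Lemma det_in n (M : 'M[S]_n) : M \is a mxOver E -> \det M \in E.
Proof. by case/mxOver_valP => N ->; rewrite det_map_mx; apply: valP. Qed.

Lemma det_mulmx_in n (M N : 'M[S]_n) : M \is a mxOver E -> N \is a mxOver E ->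
  \det (M *m N) = \det M * \det N.
Proof.
case/mxOver_valP => M' ->; case/mxOver_valP => N' ->.
by rewrite -map_mxM !det_map_mx det_mulmx rmorphM.
Qed.

Lemma det_tr_in n (M : 'M[S]_n) : M \is a mxOver E -> \det M^T = \det M.
Proof. by case/mxOver_valP => M' ->; rewrite map_trmx !det_map_mx det_tr. Qed.

Lemma det_ublock_in m n (M : 'M[S]_m) (N : 'M[S]_(m, n)) (P : 'M[S]_n) :
  M \is a mxOver E -> N \is a mxOver E -> P \is a mxOver E ->
  \det (block_mx M N 0 P) = \det M * \det P.
Proof.
case/mxOver_valP => M' ->; case/mxOver_valP => N' ->; case/mxOver_valP => P' ->.
by rewrite -(map_mx0 (val : U -> S)) -map_block_mx !det_map_mx det_ublock rmorphM.
Qed.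

Lemma det_lblock_in m n (M : 'M[S]_m) (N : 'M[S]_(n, m)) (P : 'M[S]_n) :
  M \is a mxOver E -> N \is a mxOver E -> P \is a mxOver E ->
  \det (block_mx M 0 N P) = \det M * \det P.
Proof.
case/mxOver_valP => M' ->; case/mxOver_valP => N' ->; case/mxOver_valP => P' ->.
by rewrite -(map_mx0 (val : U -> S)) -map_block_mx !det_map_mx det_lblock rmorphM.
Qed.

(** The inverse is [d] times the adjugate, so its entries stay in [E]. *)
Lemma det_unit_inverse n (M : 'M[S]_n) d :
  M \is a mxOver E -> d \in E -> \det M * d = 1 ->
  exists2 N, N \is a mxOver E & is_inverse M N.
Proof.
case/mxOver_valP => M' -> dE; rewrite det_map_mx => Md.
pose d' : U := Sub d dE.
have Md' : \det M' * d' = 1.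
  by apply: val_inj; rewrite rmorphM rmorph1 -Md; congr (_ * _); apply: SubK.
exists (map_mx val (d' *: \adj M')).
  by apply/mxOverP => i j; rewrite [map_mx _ _ i j]mxE; apply: valP.
split; rewrite -[_ * _]map_mxM -[1]/(1%:M) -(map_mx1 (val : U -> S)); congr map_mx.
  by rewrite -scalemxAr mul_mx_adj scale_scalar_mx mulrC Md'.
by rewrite -scalemxAl mul_adj_mx scale_scalar_mx mulrC Md'.
Qed.

End CommutingSubring.

(** The matrix is the image of an integer permutation matrix, so its determinant is computed over
    the commutative ring of integers. *)
Lemma det_perm_mx (T : nzRingType) n (s : 'S_n) :
  \det (perm_mx s : 'M[T]_n) = (-1) ^+ s.
Proof.
rewrite -(map_perm_mx (intmul (1 : T))) det_map_mx det_perm rmorphXn.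
by rewrite rmorphN1.
Qed.

Lemma det1_nzRing (T : nzRingType) n : \det (1%:M : 'M[T]_n) = 1.
Proof. by rewrite -perm_mx1 det_perm_mx odd_perm1. Qed.

(* Every non-identity permutation moves two points, one of which it does not
   send to [j], so it contributes 0 to the Leibniz formula. *)
Lemma det_add1_col (T : pzRingType) n (M : 'M[T]_n) j :
  (forall i k, k != j -> M i k = 0) -> \det (1%:M + M) = 1 + M j j.
Proof.
move=> M0; rewrite /determinant (bigD1 1%g) //= [X in _ + X]big1 => [|s s1].
  rewrite addr0 odd_perm1 mul1r.
  have -> : \prod_i (1%:M + M) i ((1%g : 'S_n) i)
          = \prod_i (if i == j then 1 + M j j else 1).
    apply: eq_bigr => i _; rewrite perm1 !mxE eqxx.
    by have [->//|ij] := eqVneq i j; rewrite M0 // addr0.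
  rewrite -big_mkcond /= big_pred1_eq //.
have [i si sij] : exists2 i, s i != i & s i != j.
  have /existsP[i si] : [exists i, s i != i].
    rewrite -negb_forall; apply: contra s1 => /forallP s_id.
    by apply/eqP/permP => i; rewrite perm1; apply/eqP.
  have [sij|] := eqVneq (s i) j; last by exists i.
  exists (s i); first by rewrite (inj_eq perm_inj).
  by rewrite -sij (inj_eq perm_inj).
have -> : \prod_i0 (1%:M + M) i0 (s i0) = 0; last by rewrite mulr0.
case/splitPr: (mem_index_enum i) => r1 r2.
by rewrite big_cat big_cons /= !mxE [i == _]eq_sym (negPf si) M0 // addr0 mul0r mulr0.
Qed.

(** * Berezinians *)

Lemma is_inverse_uniq (T : pzRingType) (x y z : T) :
  is_inverse x y -> is_inverse x z -> y = z.
Proof. by case=> _ yx [xz _]; rewrite -[y]mulr1 -xz mulrA yx mul1r. Qed.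

Lemma inverseP (T : pzRingType) (x y : T) : is_inverse x y -> inverse x = y.
Proof.
move=> xy; apply: (is_inverse_uniq _ xy); rewrite /inverse.
by case: xgetP => [z -> //|/(_ y)]; case.
Qed.

Section Superalgebra.
Variables (K : fieldType) (S : algType K) (part : bool -> {pred S}).
Hypothesis super : comm_superalgebra part.
Hypothesis two_neq0 : (2%:R : K) != 0.

(** * Parities of elements and of matrices *)

Lemma part_subring : subring_closed (part false).
Proof.
split; first exact: (part_one super).
  by have [_] := GRing.submod_closedB (part_submod super false); apply.
by move=> x y; apply: (part_mul super).
Qed.

Lemma part_even_comm : {in part false &, commutative (@GRing.mul S)}.
Proof. by move=> x y xE yE; rewrite (part_comm super xE yE) mul1r. Qed.

Let ring0 := part_subring.
Let comm0 := part_even_comm.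

Lemma part0 a : 0 \in part a.
Proof. by have [] := part_submod super a. Qed.

Lemma partD a x y : x \in part a -> y \in part a -> x + y \in part a.
Proof.
by move=> xa ya; have [_ /(_ 1 x y xa ya)] := part_submod super a; rewrite scale1r.
Qed.

Lemma partN a x : x \in part a -> - x \in part a.
Proof.
move=> xa; have [_ /(_ (-1) x 0 xa (part0 a))] := part_submod super a.
by rewrite scaleN1r addr0.
Qed.

Lemma part_sum_in a I (s : seq I) (P : pred I) F :
  (forall i, P i -> F i \in part a) -> \sum_(i <- s | P i) F i \in part a.
Proof.
by move=> FE; elim/big_ind: _ => //; [exact: part0 | exact: partD].
Qed.

Lemma mxpart0 a m n : (0 : 'M[S]_(m, n)) \is a mxOver (part a).
Proof. by apply/mxOverP => i j; rewrite mxE part0. Qed.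

Lemma mxpart1 n : (1%:M : 'M[S]_n) \is a mxOver (part false).
Proof.
apply/mxOverP => i j; rewrite mxE; case: eqP => _ /=; last exact: part0.
exact: (part_one super).
Qed.

Lemma mxpartD a m n (M N : 'M[S]_(m, n)) :
  M \is a mxOver (part a) -> N \is a mxOver (part a) ->
  M + N \is a mxOver (part a).
Proof.
by move=> /mxOverP Ma /mxOverP Na; apply/mxOverP => i j; rewrite mxE partD.
Qed.

Lemma mxpartN a m n (M : 'M[S]_(m, n)) :
  M \is a mxOver (part a) -> - M \is a mxOver (part a).
Proof. by move=> /mxOverP Ma; apply/mxOverP => i j; rewrite mxE partN. Qed.

Lemma mxpartM a b m n p (M : 'M[S]_(m, n)) (N : 'M[S]_(n, p)) :
  M \is a mxOver (part a) -> N \is a mxOver (part b) ->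
  M *m N \is a mxOver (part (a (+) b)).
Proof.
move=> /mxOverP Ma /mxOverP Nb; apply/mxOverP => i j; rewrite mxE.
by apply: part_sum_in => k _; apply: (part_mul super).
Qed.

Lemma mxpart_even_even m n p (M : 'M[S]_(m, n)) (N : 'M[S]_(n, p)) :
  M \is a mxOver (part false) -> N \is a mxOver (part false) ->
  M *m N \is a mxOver (part false).
Proof. exact: mxpartM. Qed.

Lemma mxpart_even_odd m n p (M : 'M[S]_(m, n)) (N : 'M[S]_(n, p)) :
  M \is a mxOver (part false) -> N \is a mxOver (part true) ->
  M *m N \is a mxOver (part true).
Proof. exact: mxpartM. Qed.

Lemma mxpart_odd_even m n p (M : 'M[S]_(m, n)) (N : 'M[S]_(n, p)) :
  M \is a mxOver (part true) -> N \is a mxOver (part false) ->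
  M *m N \is a mxOver (part true).
Proof. exact: mxpartM. Qed.

Lemma mxpart_odd_odd m n p (M : 'M[S]_(m, n)) (N : 'M[S]_(n, p)) :
  M \is a mxOver (part true) -> N \is a mxOver (part true) ->
  M *m N \is a mxOver (part false).
Proof. exact: mxpartM. Qed.

Lemma mxpart_block a m1 m2 n1 n2 (M : 'M[S]_(m1, n1)) (N : 'M[S]_(m1, n2))
    (P : 'M[S]_(m2, n1)) (Q : 'M[S]_(m2, n2)) :
  M \is a mxOver (part a) -> N \is a mxOver (part a) ->
  P \is a mxOver (part a) -> Q \is a mxOver (part a) ->
  block_mx M N P Q \is a mxOver (part a).
Proof.
move=> /mxOverP Ma /mxOverP Na /mxOverP Pa /mxOverP Qa; apply/mxOverP => i j.
by rewrite !mxE; case: (fintype.split i) => i'; rewrite mxE;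
  case: (fintype.split j).
Qed.

Lemma mxpart_sub a m n m' n' (f : 'I_m' -> 'I_m) (g : 'I_n' -> 'I_n)
    (M : 'M[S]_(m, n)) :
  M \is a mxOver (part a) -> mxsub f g M \is a mxOver (part a).
Proof. by move=> /mxOverP Ma; apply/mxOverP => i j; rewrite mxE. Qed.

Lemma mxpart_ulsub a m1 m2 n1 n2 (M : 'M[S]_(m1 + m2, n1 + n2)) :
  M \is a mxOver (part a) -> ulsubmx M \is a mxOver (part a).
Proof. by rewrite ulsubmxEsub; apply: mxpart_sub. Qed.
Lemma mxpart_ursub a m1 m2 n1 n2 (M : 'M[S]_(m1 + m2, n1 + n2)) :
  M \is a mxOver (part a) -> ursubmx M \is a mxOver (part a).
Proof. by rewrite ursubmxEsub; apply: mxpart_sub. Qed.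
Lemma mxpart_dlsub a m1 m2 n1 n2 (M : 'M[S]_(m1 + m2, n1 + n2)) :
  M \is a mxOver (part a) -> dlsubmx M \is a mxOver (part a).
Proof. by rewrite dlsubmxEsub; apply: mxpart_sub. Qed.
Lemma mxpart_drsub a m1 m2 n1 n2 (M : 'M[S]_(m1 + m2, n1 + n2)) :
  M \is a mxOver (part a) -> drsubmx M \is a mxOver (part a).
Proof. by rewrite drsubmxEsub; apply: mxpart_sub. Qed.

(** Computes parities along the structure of a matrix expression. A product can reach a given parity
    in two ways; [solve] makes the second be tried whenever the first fails deeper down. *)
Ltac parity := lazymatch goal with
  | |- is_true (0 \is a _) => apply: mxpart0
  | |- is_true (1%:M \is a _) => apply: mxpart1
  | |- is_true (- _ \is a _) => apply: mxpartN; parity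
  | |- is_true (_ + _ \is a _) => apply: mxpartD; parity
  | |- is_true (_ *m _ \is a mxOver (part false)) => solve
      [ apply: mxpart_even_even; parity | apply: mxpart_odd_odd; parity ]
  | |- is_true (_ *m _ \is a mxOver (part true)) => solve
      [ apply: mxpart_even_odd; parity | apply: mxpart_odd_even; parity ]
  | |- is_true (block_mx _ _ _ _ \is a _) => apply: mxpart_block; parity
  | |- is_true (ulsubmx _ \is a _) => first [assumption | apply: mxpart_ulsub; parity]
  | |- is_true (ursubmx _ \is a _) => first [assumption | apply: mxpart_ursub; parity]
  | |- is_true (dlsubmx _ \is a _) => first [assumption | apply: mxpart_dlsub; parity]
  | |- is_true (drsubmx _ \is a _) => first [assumption | apply: mxpart_drsub; parity]
  | |- _ => assumption
  end.

(** * The determinant identity for odd matrices *)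

(* Odd elements anticommute, so their squares are killed by 2. *)
Lemma odd_mul_swap x y : x \in part true -> y \in part true ->
  (1 + x * y) * (1 + y * x) = 1.
Proof.
move=> xo yo; have yx : y * x = - (x * y).
  by rewrite (part_comm super yo xo) expr1 mulN1r.
have xx : x * x = 0.
  have := part_comm super xo xo; rewrite expr1 mulN1r => /eqP.
  rewrite -addr_eq0 -mulr2n -scaler_nat scaler_eq0 (negPf two_neq0) /=.
  by move/eqP.
rewrite mulrDl mul1r mulrDr mulr1 yx addrA subrK mulrN.
by rewrite -mulrA [y * _]mulrA yx mulNr mulrN opprK -!mulrA [x * _]mulrA xx mul0r addr0.
Qed.

(** The odd counterpart of Sylvester's identity [det (1 + b g) = det (1 + g b)]: anticommutation
    makes the two determinants inverse to each other instead of equal. *)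
Definition det_cancels m n (b : 'M[S]_(m, n)) (g : 'M[S]_(n, m)) :=
  \det (1%:M + b *m g) * \det (1%:M + g *m b) = 1.

(** Each determinant is an inverse of the other, so both matrices are inverted by multiples of their
    adjugates, which are even. *)
Lemma det_cancels_inverse m n (b : 'M[S]_(m, n)) (g : 'M[S]_(n, m)) :
  b \is a mxOver (part true) -> g \is a mxOver (part true) -> det_cancels b g ->
  exists U V, [/\ U \is a mxOver (part false), V \is a mxOver (part false),
    is_inverse (1%:M + b *m g) U & is_inverse (1%:M + g *m b) V].
Proof.
move=> bo go bg.
have E1 : 1%:M + b *m g \is a mxOver (part false) by parity.
have E2 : 1%:M + g *m b \is a mxOver (part false) by parity.
have d1 := det_in ring0 comm0 E1; have d2 := det_in ring0 comm0 E2.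
have [U UE HU] := det_unit_inverse ring0 comm0 E1 d2 bg.
rewrite /det_cancels comm0 // in bg.
have [V VE HV] := det_unit_inverse ring0 comm0 E2 d1 bg.
by exists U, V.
Qed.

(** Here [b g] lives in column [j] and [g b] in row [i], so the determinants are [1 + b_ji x] and
    [1 + x b_ji]. Transposing the second one makes [det_add1_col] apply to both. *)
Lemma det_cancels_delta m n (b : 'M[S]_(m, n)) x i j :
  b \is a mxOver (part true) -> x \in part true ->
  det_cancels b (x *: delta_mx i j).
Proof.
move=> bo xo; set g := x *: _.
have go : g \is a mxOver (part true).
  apply/mxOverP => k l; rewrite !mxE.
  by case: (_ && _); rewrite ?mulr1 ?mulr0 ?part0.
have bgE k l : (b *m g) k l = b k i * x *+ (l == j).
  rewrite !mxE (bigD1 i) //= !mxE eqxx /= big1 ?addr0.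
    by case: eqP; rewrite ?mulr1 // !mulr0.
  by move=> k' /negPf nk; rewrite !mxE nk /= !mulr0.
have gbE k l : (g *m b) k l = x * b j l *+ (k == i).
  rewrite !mxE (bigD1 j) //= !mxE eqxx /= big1 ?addr0.
    by rewrite andbT; case: eqP; rewrite ?mulr1 // !mulr0 mul0r.
  by move=> k' /negPf nk; rewrite !mxE nk /= andbF !mulr0 mul0r.
rewrite /det_cancels -[\det (1%:M + g *m b)](det_tr_in ring0 comm0);
  last by parity.
rewrite linearD /= trmx1 (det_add1_col (j := j)) ?(det_add1_col (j := i)).
- rewrite bgE [_^T i i]mxE gbE !eqxx !mulr1n; apply: odd_mul_swap => //.
  by move/mxOverP: bo.
- by move=> k l /negPf li; rewrite mxE gbE li.
- by move=> k l /negPf lj; rewrite bgE lj.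
Qed.

(* With [U] inverse to [1 + b g], both determinants for [g + g'] factor through
   those for [(b, g)] and [(U b, g')]; so the identity only has to be checked
   on matrices [g] with a single nonzero entry. *)
Lemma det_cancels_odd m n (b : 'M[S]_(m, n)) (g : 'M[S]_(n, m)) :
  b \is a mxOver (part true) -> g \is a mxOver (part true) -> det_cancels b g.
Proof.
(* The property quantifies over all odd [b], since the additive step replaces [b] by [U b]. *)
move=> bo go; pose P g := g \is a mxOver (part true) /\
  forall b : 'M[S]_(m, n), b \is a mxOver (part true) -> det_cancels b g.
suff [_ ] : P g by apply.
have P0 : P 0.
  split=> [|c _]; first by parity.
  by rewrite /det_cancels mulmx0 mul0mx !addr0 !det1_nzRing mulr1.
have PD g1 g2 : P g1 -> P g2 -> P (g1 + g2).
  move=> [g1o H1] [g2o H2]; split=> [|c co]; first by parity.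
  have H := H1 _ co; have [U [V [UE VE [UK KU] [VK KV]]]] := det_cancels_inverse co g1o H.
  (* Push-through identity: [(1 + c g1) c = c (1 + g1 c)], multiplied by [U] on the left and by [V]
     on the right. *)
  have cV : U *m c = c *m V.
    have /(congr1 (fun M => U *m M *m V)) :
        (1%:M + c *m g1) *m c = c *m (1%:M + g1 *m c).
      by rewrite mulmxDl mulmxDr mul1mx mulmx1 mulmxA.
    rewrite !mulmxA [U *m _]KU mul1mx -!mulmxA => ->.
    by rewrite [(_ + _) *m V]VK mulmx1.
  have e1 : 1%:M + c *m (g1 + g2) = (1%:M + c *m g1) *m (1%:M + U *m c *m g2).
    by rewrite mulmxDr mulmx1 !mulmxA [_ *m U]UK mul1mx mulmxDr addrA.
  have e2 : 1%:M + (g1 + g2) *m c = (1%:M + g2 *m (U *m c)) *m (1%:M + g1 *m c).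
    rewrite cV mulmxDl mul1mx -!mulmxA [V *m _]KV mulmx1 mulmxDl.
    by rewrite addrA.
  have Uco : U *m c \is a mxOver (part true) by parity.
  rewrite /det_cancels e1 e2 !(det_mulmx_in ring0 comm0); try parity.
  (* The product collapses from the inside: first the two factors with [g2], then those with [g1],
     by [H]. *)
  by rewrite mulrA -[X in X * _]mulrA [X in _ * X * _](H2 _ Uco) mulr1.
rewrite [g]matrix_sum_delta; do 2!elim/big_ind: _ => // ? _.
split=> [|c co]; last by apply: det_cancels_delta => //; move/mxOverP: go.
apply/mxOverP => k l; rewrite !mxE; move/mxOverP: go.
by case: (_ && _); rewrite ?mulr1 ?mulr0 ?part0.
Qed.

(** * Inverses of even supermatrices *)

(* The component of [N] of the wrong parity is annihilated by [M], so it is 0. *)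
Lemma graded_inverse n (w : 'I_n -> bool) (M N : 'M[S]_n) :
  (forall i j, M i j \in part (w i (+) w j)) -> is_inverse M N ->
  forall i j, N i j \in part (w i (+) w j).
Proof.
move=> Mw [MN NM].
(* [z.1] is the component of the expected parity and [z.2] the other one. *)
pose dec (ij : 'I_n * 'I_n) (z : S * S) :=
  [/\ z.1 \in part (w ij.1 (+) w ij.2), z.2 \in part (~~ (w ij.1 (+) w ij.2)) &
      N ij.1 ij.2 = z.1 + z.2].
have /boolp.choice[h hP] : forall ij, exists z, dec ij z.
  case=> i j; have [x0 [x1 [x0E x1O NE]]] := part_sum super (N i j).
  rewrite /dec /=; case: (w i (+) w j); [exists (x1, x0) | exists (x0, x1)] => //.
  by split=> //; rewrite addrC.
pose N0 := \matrix_(i, j) (h (i, j)).1; pose N1 := \matrix_(i, j) (h (i, j)).2.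
have NE : N = N0 + N1.
  by apply/matrixP => i j; rewrite !mxE; have [_ _] := hP (i, j).
(* By its factors the product has the wrong parity; as [1 - M N0] it has the right one. Both
   together force 0. *)
have MN1 : M *m N1 = 0.
  apply/matrixP => i j; rewrite [RHS]mxE.
  have e1 : (M *m N1) i j \in part (~~ (w i (+) w j)).
    rewrite mxE; apply: part_sum_in => k _.
    have [_ N1kj _] := hP (k, j).
    have := part_mul super (Mw i k) N1kj; rewrite /= mxE.
    by case: (w i) (w j) (w k) => [] [] [].
  have e2 : (M *m N1) i j \in part (w i (+) w j).
    have -> : M *m N1 = 1%:M - M *m N0.
      by rewrite -[1%:M]MN NE [M * _]mulmxDr addrC addKr.
    rewrite mxE; apply: partD.
      rewrite mxE; case: eqP => [<-|_] /=; last exact: part0.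
      by rewrite addbb; apply: (part_one super).
    rewrite mxE; apply: partN; rewrite mxE; apply: part_sum_in => k _.
    have [N0kj _ _] := hP (k, j).
    have := part_mul super (Mw i k) N0kj; rewrite /= mxE.
    by case: (w i) (w j) (w k) => [] [] [].
  by move: e1 e2; case: (w i (+) w j) => /= e1 e2; apply: (part_direct super).
have N10 : N1 = 0.
  by rewrite -[N1]mul1mx -[1%:M]NM -[(N * M) *m _]mulmxA MN1 mulmx0.
move=> i j; rewrite NE N10 addr0 mxE.
by have [] := hP (i, j).
Qed.

Lemma even_inverse n (M N : 'M[S]_n) :
  M \is a mxOver (part false) -> is_inverse M N -> N \is a mxOver (part false).
Proof.
move=> /mxOverP ME MN; apply/mxOverP => i j.
exact: (@graded_inverse n (fun=> false) M N).
Qed.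

(** Restates the block condition entrywise, with the weight [m <= i] marking odd indices, which is
    the form required by [graded_inverse]. *)
Lemma even_supermatrixP m n (B : 'M[S]_(m + n)) :
  even_supermatrix part B <->
  forall i j, B i j \in part ((m <= i)%N (+) (m <= j)%N).
Proof.
split=> [[/mxOverP ul /mxOverP ur /mxOverP dl /mxOverP dr] i j|BE].
  rewrite -(splitK i) -(splitK j).
  case: (fintype.split i) (fintype.split j) => i' [] j' /=;
    rewrite ?leq_addr ?(leqNgt m) ?ltn_ord /=.
  - by have := ul i' j'; rewrite !mxE.
  - by have := ur i' j'; rewrite !mxE.
  - by have := dl i' j'; rewrite !mxE.
  - by have := dr i' j'; rewrite !mxE.
split; apply/mxOverP => i j; rewrite !mxE.
- by have := BE (lshift n i) (lshift n j); rewrite /= !(leqNgt m) !ltn_ord.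
- by have := BE (lshift n i) (rshift m j); rewrite /= leq_addr !(leqNgt m) !ltn_ord.
- by have := BE (rshift m i) (lshift n j); rewrite /= leq_addr !(leqNgt m) !ltn_ord.
- by have := BE (rshift m i) (rshift m j); rewrite /= !leq_addr.
Qed.

Lemma even_supermatrix_inverse m n (B C : 'M[S]_(m + n)) :
  even_supermatrix part B -> is_inverse B C -> even_supermatrix part C.
Proof.
rewrite !even_supermatrixP => BE BC.
exact: (@graded_inverse _ (fun i : 'I_(m + n) => (m <= i)%N) B C BE BC).
Qed.

(* [B4 C4 = 1 - B3 C2], whose determinant is a unit by [det_cancels_odd]. *)
Lemma drsubmx_invertible m n (B : 'M[S]_(m + n)) :
  even_supermatrix part B -> invertible B -> invertible (drsubmx B).
Proof.
move=> BE [C BC]; have CE := even_supermatrix_inverse BE BC.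
case: BE CE BC => [B1 B2 B3 B4] [C1 C2 C3 C4] [BC _].
have : drsubmx B *m drsubmx C = 1%:M + (- dlsubmx B) *m ursubmx C.
  have := BC; rewrite -[B * C]/(B *m C) -[1]/(1%:M) -{1}(submxK B) -{1}(submxK C).
  rewrite mulmx_block [1%:M]scalar_mx_block => /eq_block_mx[_ _ _ <-].
  by rewrite mulNmx addrC addKr.
move/(congr1 determinant); rewrite (det_mulmx_in ring0 comm0) // => detBC.
have H : det_cancels (- dlsubmx B) (ursubmx C).
  by apply: det_cancels_odd; parity.
rewrite /det_cancels -detBC -mulrA in H.
have [||N _ BN] := det_unit_inverse ring0 comm0 _ _ H; [by []| |by exists N].
apply: (part_mul super (a := false) (b := false));
  apply: (det_in ring0 comm0); parity.
Qed.

(** * Multiplicativity of the Berezinian *)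

Lemma det_inverse n (M N : 'M[S]_n) :
  M \is a mxOver (part false) -> is_inverse M N -> is_inverse (\det M) (\det N).
Proof.
move=> ME MN; have NE := even_inverse ME MN; case: MN => MN NM.
by split; rewrite -(det_mulmx_in ring0 comm0) // -[_ *m _]/(_ * _) ?MN ?NM det1_nzRing.
Qed.

(** Replaces the chosen inverses in [Ber] by an explicit inverse [N] of [B4] and its determinant. *)
Lemma BerE m n (B1 : 'M[S]_m) (B2 : 'M[S]_(m, n)) B3 (B4 N : 'M[S]_n) :
  B4 \is a mxOver (part false) -> is_inverse B4 N ->
  Ber (block_mx B1 B2 B3 B4) = \det N * \det (B1 - B2 *m N *m B3).
Proof.
move=> B4E BN; rewrite /Ber block_mxKul block_mxKur block_mxKdl block_mxKdr.
by rewrite (inverseP BN) (inverseP (det_inverse B4E BN)).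
Qed.

(** The final regrouping in [BerM], where [b] and [e] are the determinants of the two middle factors
    [W] and [V]. *)
Lemma even_mulACA (a b c d e f : S) :
  a \in part false -> b \in part false -> c \in part false ->
  d \in part false -> e \in part false -> f \in part false ->
  b * e = 1 -> (a * b * c) * (d * e * f) = (c * d) * (a * f).
Proof.
move=> aE bE cE dE eE fE be.
have cdE : c * d \in part false by exact: (part_mul super cE dE).
rewrite -!mulrA [c * (d * _)]mulrA [b * _]mulrA (comm0 bE cdE) -[c * d * b * _]mulrA.
by rewrite [b * _]mulrA be mul1r mulrA (comm0 aE cdE) !mulrA.
Qed.

(** The Schur complement of a product, with the outer factors of the odd-odd block absorbed into [b]
    and [g]. Push-through gives [V b = b W] and [g V = W g], hence [V = 1 - b W g] and
    [g V b = 1 - W]; both sides then expand to the same six terms. *)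
Lemma schur_mul m m' n n' (X : 'M[S]_(m', m)) (Y : 'M[S]_(m', n))
    (X' : 'M[S]_(m, n')) (Z : 'M[S]_(n, n')) (b : 'M[S]_(m, n))
    (g : 'M[S]_(n, m)) V W :
  is_inverse (1%:M + b *m g) V -> is_inverse (1%:M + g *m b) W ->
  X *m X' + Y *m Z - (X *m b + Y) *m W *m (g *m X' + Z) =
  (X - Y *m g) *m V *m (X' - b *m Z).
Proof.
move=> [bgV Vbg] [gbW Wgb].
have Vb : V *m b = b *m W.
  have /(congr1 (fun M => V *m M *m W)) :
      (1%:M + b *m g) *m b = b *m (1%:M + g *m b).
    by rewrite mulmxDl mulmxDr mul1mx mulmx1 mulmxA.
  rewrite !mulmxA [V *m _]Vbg mul1mx -!mulmxA => ->.
  by rewrite [(_ + _) *m W]gbW mulmx1.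
have gV : g *m V = W *m g.
  have /(congr1 (fun M => W *m M *m V)) :
      (1%:M + g *m b) *m g = g *m (1%:M + b *m g).
    by rewrite mulmxDl mulmxDr mul1mx mulmx1 mulmxA.
  rewrite !mulmxA [W *m _]Wgb mul1mx -!mulmxA => ->.
  by rewrite [(_ + _) *m V]bgV mulmx1.
have VE : V = 1%:M - b *m W *m g.
  by rewrite -Vb -[1%:M]Vbg -[V * _]/(V *m _) mulmxDr mulmx1 mulmxA addrK.
have gVb : g *m V *m b = 1%:M - W.
  by rewrite gV -[1%:M]Wgb -[W * _]/(W *m _) mulmxDr mulmx1 mulmxA addrC addKr.
have -> : (X - Y *m g) *m V *m (X' - b *m Z) =
   X *m V *m X' - X *m (V *m b) *m Z - Y *m (g *m V) *m X'
   + Y *m (g *m V *m b) *m Z.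
  rewrite mulmxBl mulmxBr !mulmxBl opprB addrA !mulmxA.
  by rewrite [LHS](ACl (1*4*2*3)).
rewrite gVb Vb gV VE mulmxBr mulmx1 mulmxBl mulmxBr mulmx1 mulmxBl.
rewrite mulmxDr 2!mulmxDl mulmxDl !mulmxA !opprD !addrA.
by rewrite [LHS](ACl (1*3*5*4*2*6)).
Qed.

Lemma BerM m n (B1 B1' : 'M[S]_m) (B2 B2' : 'M[S]_(m, n)) B3 B3' (B4 B4' : 'M[S]_n) :
  let B := block_mx B1 B2 B3 B4 in let B' := block_mx B1' B2' B3' B4' in
  even_supermatrix part B -> even_supermatrix part B' ->
  invertible B4 -> invertible B4' -> Ber (B *m B') = Ber B * Ber B'.
Proof.
move=> B B'; rewrite /even_supermatrix !block_mxKul !block_mxKur !block_mxKdl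
  !block_mxKdr => -[E1 E2 E3 E4] [E1' E2' E3' E4'] [N BN] [N' BN'].
have NE := even_inverse E4 BN; have NE' := even_inverse E4' BN'.
rewrite (BerE B1 B2 B3 E4 BN) (BerE B1' B2' B3' E4' BN').
have [B4N NB4] := BN; have [B4N' NB4'] := BN'.
pose g := N *m B3; pose b := B2' *m N'.
have gO : g \is a mxOver (part true) by rewrite /g; parity.
have bO : b \is a mxOver (part true) by rewrite /b; parity.
have gE : g = N *m B3 by [].
have bE : b = B2' *m N' by [].
clearbody g b.
have bg := det_cancels_odd bO gO.
have [V [W [VE WE Vi Wi]]] := det_cancels_inverse bO gO bg.
have E4'' : B3 *m B2' + B4 *m B4' \is a mxOver (part false) by parity.
(* The odd-odd block of the product, factored so that its inverse can be read off. *)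
have E4''E : B3 *m B2' + B4 *m B4' = B4 *m (1%:M + g *m b) *m B4'.
  rewrite mulmxDr mulmx1 mulmxDl addrC gE bE !mulmxA [B4 *m N]B4N mul1mx.
  by rewrite -[_ *m N' *m _]mulmxA [N' *m _]NB4' mulmx1.
have inv4 : is_inverse (B3 *m B2' + B4 *m B4') (N' *m W *m N).
  rewrite E4''E; case: Wi => gbW Wgb; split.
    rewrite -[LHS]/(_ *m _) !mulmxA -[_ *m B4' *m N']mulmxA [B4' *m _]B4N' mulmx1.
    by rewrite -[_ *m _ *m W]mulmxA [_ *m W]gbW mulmx1.
  rewrite -[LHS]/(_ *m _) !mulmxA -[_ *m N *m B4]mulmxA [N *m _]NB4 mulmx1.
  by rewrite -[_ *m W *m _]mulmxA [W *m _]Wgb mulmx1.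
rewrite mulmx_block (BerE _ _ _ E4'' inv4).
have -> : B1 *m B1' + B2 *m B3' - (B1 *m B2' + B2 *m B4') *m (N' *m W *m N)
    *m (B3 *m B1' + B4 *m B3') = (B1 - B2 *m g) *m V *m (B1' - b *m B3').
  rewrite -(schur_mul B1 B2 B1' B3' Vi Wi) gE bE -!mulmxA; congr (_ - _).
  rewrite [N *m _]mulmxDr !mulmxA [N *m B4]NB4 mul1mx mulmxDl.
  by rewrite -[B2 *m B4' *m N']mulmxA [B4' *m _]B4N' mulmx1.
(* Both [\det V] and [\det (1 + g b)] invert [\det (1 + b g)], hence they agree, and [\det W]
   inverts the latter of the two. *)
have VW : \det W * \det V = 1.
  have bgE : 1%:M + b *m g \is a mxOver (part false) by parity.
  have gbE : 1%:M + g *m b \is a mxOver (part false) by parity.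
  have dbg := det_in ring0 comm0 bgE; have dgb := det_in ring0 comm0 gbE.
  have [_ <-] := det_inverse gbE Wi; congr (_ * _).
  by apply: is_inverse_uniq (det_inverse bgE Vi) _; split; last rewrite comm0.
rewrite !(det_mulmx_in ring0 comm0); try parity.
rewrite -[B2 *m N *m B3]mulmxA -gE -bE.
by apply: even_mulACA => //; apply: (det_in ring0 comm0); parity.
Qed.

(** * Complementary superblocks of a supermatrix and its inverse *)

Section Complement.
Variables a r b s : nat.

Lemma block_inverse_u n1 n2 (y : 'M[S]_(n1, n2)) F G :
  is_inverse F G ->
  is_inverse (block_mx 1%:M y 0 F) (block_mx 1%:M (- y *m G) 0 G).
Proof.
move=> [FG GF]; split; rewrite -[LHS]/(_ *m _) mulmx_block.
  by rewrite !mulmx1 !mul1mx !mulmx0 !mul0mx !addr0 !add0r [F *m _]FG mulNmx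
    addNr -scalar_mx_block.
rewrite !mulmx1 !mul1mx !mulmx0 !mul0mx !addr0 !add0r [G *m _]GF !mulNmx.
by rewrite -mulmxA [G *m _]GF mulmx1 subrr -scalar_mx_block.
Qed.

Lemma block_inverse_l n1 n2 (z : 'M[S]_(n2, n1)) X Y :
  is_inverse X Y ->
  is_inverse (block_mx X 0 z 1%:M) (block_mx Y 0 (- z *m Y) 1%:M).
Proof.
move=> [XY YX]; split; rewrite -[LHS]/(_ *m _) mulmx_block.
  by rewrite !mulmx1 !mul1mx !mulmx0 !mul0mx !addr0 !add0r [X *m _]XY mulNmx
    addrN -scalar_mx_block.
rewrite !mulmx1 !mul1mx !mulmx0 !mul0mx !addr0 !add0r [Y *m _]YX !mulNmx.
by rewrite -mulmxA [Y *m _]YX mulmx1 addNr -scalar_mx_block.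
Qed.

(** This is [(1 Y; 0 F)] with rows and columns regrouped by parity, which makes each of the four
    blocks upper triangular. So is the Schur complement, with diagonal blocks 1 and the Schur
    complement of [F]. *)
Lemma Ber_ublock (y1 : 'M[S]_(a, r)) (y2 : 'M_(a, s)) (y3 : 'M_(b, r))
    (y4 : 'M_(b, s)) (F1 : 'M_r) (F2 : 'M_(r, s)) F3 (F4 : 'M_s) :
  y1 \is a mxOver (part false) -> y2 \is a mxOver (part true) ->
  y4 \is a mxOver (part false) ->
  even_supermatrix part (block_mx F1 F2 F3 F4) -> invertible F4 ->
  Ber (block_mx (block_mx 1%:M y1 0 F1) (block_mx 0 y2 0 F2)
                (block_mx 0 y3 0 F3) (block_mx 1%:M y4 0 F4)) =
  Ber (block_mx F1 F2 F3 F4).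
Proof.
move=> y1E y2O y4E; rewrite /even_supermatrix block_mxKul block_mxKur
  block_mxKdl block_mxKdr => -[F1E F2O F3O F4E] [G FG].
have GE := even_inverse F4E FG.
rewrite (BerE _ _ _ F4E FG) (BerE _ _ _ _ (block_inverse_u y4 FG)); last by parity.
rewrite (det_ublock_in ring0 comm0); try parity.
rewrite !mulmx_block opp_block_mx add_block_mx.
rewrite !(mulmx0, mul0mx, addr0, add0r, subr0, oppr0).
rewrite (det_ublock_in ring0 comm0); try parity.
by rewrite !det1_nzRing !mul1r.
Qed.

(** The mirror case [(X 0; Z 1)], with lower triangular blocks. *)
Lemma Ber_lblock (X1 : 'M[S]_a) (X2 : 'M_(a, b)) X3 (X4 : 'M_b)
    (z1 : 'M_(r, a)) (z2 : 'M_(r, b)) (z3 : 'M_(s, a)) (z4 : 'M_(s, b)) :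
  z1 \is a mxOver (part false) -> z2 \is a mxOver (part true) ->
  z4 \is a mxOver (part false) ->
  even_supermatrix part (block_mx X1 X2 X3 X4) -> invertible X4 ->
  Ber (block_mx (block_mx X1 0 z1 1%:M) (block_mx X2 0 z2 0)
                (block_mx X3 0 z3 0) (block_mx X4 0 z4 1%:M)) =
  Ber (block_mx X1 X2 X3 X4).
Proof.
move=> z1E z2O z4E; rewrite /even_supermatrix block_mxKul block_mxKur
  block_mxKdl block_mxKdr => -[X1E X2O X3O X4E] [Y XY].
have YE := even_inverse X4E XY.
rewrite (BerE _ _ _ X4E XY) (BerE _ _ _ _ (block_inverse_l z4 XY)); last by parity.
rewrite (det_lblock_in ring0 comm0); try parity.
rewrite !mulmx_block opp_block_mx add_block_mx.
rewrite !(mulmx0, mul0mx, addr0, add0r, subr0, oppr0).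
rewrite (det_lblock_in ring0 comm0); try parity.
by rewrite !det1_nzRing !mulr1.
Qed.

(** The even indices are split as [a + r] and the odd ones as [b + s]; the first superblock collects
    the first [a] even and the first [b] odd indices. *)
Definition ul_super (M : 'M[S]_((a + r) + (b + s))) : 'M[S]_(a + b) :=
  block_mx (ulsubmx (ulsubmx M)) (ulsubmx (ursubmx M))
           (ulsubmx (dlsubmx M)) (ulsubmx (drsubmx M)).

Definition dr_super (M : 'M[S]_((a + r) + (b + s))) : 'M[S]_(r + s) :=
  block_mx (drsubmx (ulsubmx M)) (drsubmx (ursubmx M))
           (drsubmx (dlsubmx M)) (drsubmx (drsubmx M)).

Lemma mulmx_left_columns m1 m2 n1 n2 (M : 'M[S]_(m1 + m2, n1 + n2)) :
  M *m (block_mx 1%:M 0 0 0 : 'M_(n1 + n2)) =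
  block_mx (ulsubmx M) 0 (dlsubmx M) 0.
Proof.
by rewrite -{1}[M]submxK mulmx_block !mulmx0 !mulmx1 !addr0.
Qed.

Lemma mulmx_right_columns m1 m2 n1 n2 (M : 'M[S]_(m1 + m2, n1 + n2)) :
  M *m (block_mx 0 0 0 1%:M : 'M_(n1 + n2)) =
  block_mx 0 (ursubmx M) 0 (drsubmx M).
Proof.
by rewrite -{1}[M]submxK mulmx_block !mulmx0 !mulmx1 !add0r.
Qed.

(* If [T] has the columns of [D] at the second indices and those of the identity
   matrix at the first ones, then [A T] has the columns of [A] at the first
   indices and those of the identity matrix at the second ones. *)
Lemma Ber_complement (A D : 'M[S]_((a + r) + (b + s))) :
  even_supermatrix part A -> is_inverse A D ->
  invertible (ul_super A) -> invertible (dr_super D) ->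
  Ber A * Ber (dr_super D) = Ber (ul_super A).
Proof.
move=> AE AD Xi Fi; have DE := even_supermatrix_inverse AE AD.
have A4i := drsubmx_invertible AE (ex_intro _ D AD).
have XE : even_supermatrix part (ul_super A).
  case: AE => *; rewrite /even_supermatrix block_mxKul block_mxKur block_mxKdl
    block_mxKdr; split; parity.
have FE : even_supermatrix part (dr_super D).
  case: DE => *; rewrite /even_supermatrix block_mxKul block_mxKur block_mxKdl
    block_mxKdr; split; parity.
have := drsubmx_invertible XE Xi; rewrite block_mxKdr => X4i.
have := drsubmx_invertible FE Fi; rewrite block_mxKdr => F4i.
case: AE DE => A1E A2O A3O A4E [D1E D2O D3O D4E].
pose T1 := block_mx 1%:M (ursubmx (ulsubmx D)) 0 (drsubmx (ulsubmx D)).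
pose T2 : 'M_(a + r, b + s) := block_mx 0 (ursubmx (ursubmx D)) 0 (drsubmx (ursubmx D)).
pose T3 : 'M_(b + s, a + r) := block_mx 0 (ursubmx (dlsubmx D)) 0 (drsubmx (dlsubmx D)).
pose T4 := block_mx 1%:M (ursubmx (drsubmx D)) 0 (drsubmx (drsubmx D)).
have TE : even_supermatrix part (block_mx T1 T2 T3 T4).
  rewrite /even_supermatrix block_mxKul block_mxKur block_mxKdl block_mxKdr.
  by split; rewrite ?/T1 ?/T2 ?/T3 ?/T4; parity.
have ATE : A *m block_mx T1 T2 T3 T4 =
    block_mx (block_mx (ulsubmx (ulsubmx A)) 0 (dlsubmx (ulsubmx A)) 1%:M)
             (block_mx (ulsubmx (ursubmx A)) 0 (dlsubmx (ursubmx A)) 0)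
             (block_mx (ulsubmx (dlsubmx A)) 0 (dlsubmx (dlsubmx A)) 0)
             (block_mx (ulsubmx (drsubmx A)) 0 (dlsubmx (drsubmx A)) 1%:M).
  have := AD.1; rewrite -[A * D]/(A *m D) -[1]/(1%:M).
  rewrite -{1}(submxK A) -{1}(submxK D) mulmx_block [1%:M]scalar_mx_block.
  case/eq_block_mx=> e1 e2 e3 e4.
  (* With [P] and [Q] the projections onto the first and second indices, [T = P + D Q], so
     [A T = A P + Q]. *)
  have -> : T1 = block_mx 1%:M 0 0 0 + ulsubmx D *m block_mx 0 0 0 1%:M.
    by rewrite mulmx_right_columns add_block_mx !addr0 !add0r.
  have -> : T2 = ursubmx D *m block_mx 0 0 0 1%:M.
    by rewrite mulmx_right_columns.
  have -> : T3 = dlsubmx D *m block_mx 0 0 0 1%:M.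
    by rewrite mulmx_right_columns.
  have -> : T4 = block_mx 1%:M 0 0 0 + drsubmx D *m block_mx 0 0 0 1%:M.
    by rewrite mulmx_right_columns add_block_mx !addr0 !add0r.
  rewrite -{1}(submxK A) mulmx_block; congr block_mx.
  - rewrite mulmxDr -addrA !mulmxA -mulmxDl e1 mul1mx mulmx_left_columns.
    by rewrite add_block_mx !addr0 add0r.
  - rewrite mulmxDr addrCA !mulmxA -mulmxDl e2 mul0mx addr0.
    exact: mulmx_left_columns.
  - rewrite mulmxDr -addrA !mulmxA -mulmxDl e3 mul0mx addr0.
    exact: mulmx_left_columns.
  - rewrite mulmxDr addrCA !mulmxA -mulmxDl e4 mul1mx mulmx_left_columns.
    by rewrite add_block_mx !addr0 add0r.
have T4i : invertible T4.
  by have [G FG] := F4i; eexists; apply: block_inverse_u FG.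
have y1E : ursubmx (ulsubmx D) \is a mxOver (part false) by parity.
have y2O : ursubmx (ursubmx D) \is a mxOver (part true) by parity.
have y4E : ursubmx (drsubmx D) \is a mxOver (part false) by parity.
have z1E : dlsubmx (ulsubmx A) \is a mxOver (part false) by parity.
have z2O : dlsubmx (ursubmx A) \is a mxOver (part true) by parity.
have z4E : dlsubmx (drsubmx A) \is a mxOver (part false) by parity.
rewrite -(Ber_ublock (ursubmx (dlsubmx D)) y1E y2O y4E FE F4i).
have AE : even_supermatrix part (block_mx (ulsubmx A) (ursubmx A) (dlsubmx A)
  (drsubmx A)) by rewrite submxK.
have := BerM AE TE A4i T4i; rewrite submxK ATE => <-.
exact: Ber_lblock.
Qed.

End Complement.

(** * Column permutations and rotated blocks *)

Lemma sub_perm_superblock m n (A : 'M[S]_(m + n)) (s : 'S_m) (t : 'S_n) :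
  A *m block_mx (perm_mx s^-1) 0 0 (perm_mx t^-1) =
  block_mx (col_perm s (ulsubmx A)) (col_perm t (ursubmx A))
           (col_perm s (dlsubmx A)) (col_perm t (drsubmx A)).
Proof.
by rewrite -{1}[A]submxK mulmx_block !mulmx0 !addr0 !add0r !col_permE.
Qed.

(** The even permutation multiplies the Schur complement, where the odd one cancels; the odd one
    multiplies the inverse of the odd-odd block. A sign is its own inverse, so both contribute in
    the same way. *)
Lemma Ber_col_perm m n (A : 'M[S]_(m + n)) (s : 'S_m) (t : 'S_n) :
  even_supermatrix part A -> invertible A ->
  Ber (block_mx (col_perm s (ulsubmx A)) (col_perm t (ursubmx A))
                (col_perm s (dlsubmx A)) (col_perm t (drsubmx A))) =
  (-1) ^+ (odd_perm s (+) odd_perm t) * Ber A.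
Proof.
move=> AE Ai; have [N AN] := drsubmx_invertible AE Ai.
case: AE => A1E A2O A3O A4E; have NE := even_inverse A4E AN.
have permE k (u : 'S_k) : (perm_mx u : 'M[S]_k) \is a mxOver (part false).
  apply/mxOverP => i j; rewrite !mxE; case: (_ == _); last exact: part0.
  exact: (part_one super).
have signC u (x : S) : x * (-1) ^+ u = (-1) ^+ u * x by rewrite commr_sign.
rewrite !col_permE.
have AtN : is_inverse (drsubmx A *m perm_mx t^-1) (perm_mx t *m N).
  have [AN1 NA1] := AN; split; rewrite -[LHS]/(_ *m _) mulmxA.
    by rewrite -[_ *m _ *m perm_mx t]mulmxA -perm_mxM mulVg perm_mx1 mulmx1.
  rewrite -[_ *m N *m _]mulmxA [N *m _]NA1 mulmx1.
  by rewrite -perm_mxM mulgV perm_mx1.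
rewrite (BerE _ _ _ _ AtN); last by apply: mxpart_even_even.
rewrite -[in RHS](submxK A) (BerE _ _ _ A4E AN).
have -> : ulsubmx A *m perm_mx s^-1 -
    ursubmx A *m perm_mx t^-1 *m (perm_mx t *m N) *m (dlsubmx A *m perm_mx s^-1)
  = (ulsubmx A - ursubmx A *m N *m dlsubmx A) *m perm_mx s^-1.
  rewrite mulmxBl !mulmxA -[_ *m _ *m perm_mx t]mulmxA -perm_mxM mulVg perm_mx1.
  by rewrite mulmx1.
rewrite !(det_mulmx_in ring0 comm0) //; try parity.
rewrite !det_perm_mx odd_permV signr_addb.
rewrite [\det _ * (-1) ^+ s]signC [_ * (-1) ^+ t]signC -!mulrA; congr (_ * _).
by rewrite mulrA [\det N * (-1) ^+ _]signC -mulrA.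
Qed.

(* Rotating the even columns by [r] and the odd ones by [s] brings the columns
   kept in [A^u_v] to the front; [D] has its rows rotated accordingly. *)
Lemma Ber_rotated_complement p q a r b s (pE : (a + r)%N = p) (qE : (b + s)%N = q)
    (sg : 'S_p) (tu : 'S_q) (A D : 'M[S]_(p + q)) :
  let ea := cast_ord pE \o lshift r in let er := cast_ord pE \o @rshift a r in
  let ob := cast_ord qE \o lshift s in let os := cast_ord qE \o @rshift b s in
  let X := block_mx
    (mxsub ea (sg \o ea) (ulsubmx A)) (mxsub ea (tu \o ob) (ursubmx A))
    (mxsub ob (sg \o ea) (dlsubmx A)) (mxsub ob (tu \o ob) (drsubmx A)) in
  let F := block_mx
    (mxsub (sg \o er) er (ulsubmx D)) (mxsub (sg \o er) os (ursubmx D))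
    (mxsub (tu \o os) er (dlsubmx D)) (mxsub (tu \o os) os (drsubmx D)) in
  even_supermatrix part A -> is_inverse A D -> invertible X -> invertible F ->
  Ber A * Ber F = (-1) ^+ (odd_perm sg (+) odd_perm tu) * Ber X.
Proof.
(* Once [p] and [q] are literally [a + r] and [b + s], the casts are identities. *)
case: p / pE sg A D; case: q / qE tu => tu sg A D ea er ob os X F AE AD Xi Fi.
pose P := block_mx (perm_mx sg : 'M[S]_(a + r)) 0 0 (perm_mx tu : 'M_(b + s)).
pose P' := block_mx (perm_mx sg^-1 : 'M[S]_(a + r)) 0 0 (perm_mx tu^-1 : 'M_(b + s)).
have PP' : is_inverse P P'.
  by split; rewrite -[LHS]/(_ *m _) mulmx_block !mulmx0 !mul0mx !addr0 !add0r
    -!perm_mxM ?mulgV ?mulVg !perm_mx1 -scalar_mx_block.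
have Ai : invertible A by exists D.
have A'E : A *m P' = block_mx (col_perm sg (ulsubmx A)) (col_perm tu (ursubmx A))
    (col_perm sg (dlsubmx A)) (col_perm tu (drsubmx A)).
  exact: sub_perm_superblock.
have D'E : P *m D = block_mx (row_perm sg (ulsubmx D)) (row_perm sg (ursubmx D))
    (row_perm tu (dlsubmx D)) (row_perm tu (drsubmx D)).
  by rewrite -{1}[D]submxK mulmx_block !mul0mx !addr0 !add0r !row_permE.
have A'D' : is_inverse (A *m P') (P *m D).
  case: AD PP' => [AD DA] [PP' P'P]; split; rewrite -[LHS]/(_ *m _) mulmxA.
    by rewrite -[_ *m P' *m P]mulmxA [P' *m P]P'P mulmx1.
  by rewrite -[P *m D *m A]mulmxA [D *m A]DA mulmx1.
have XE : X = ul_super (A *m P').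
  rewrite A'E /ul_super block_mxKul block_mxKur block_mxKdl block_mxKdr.
  by congr block_mx; apply/matrixP => i j; rewrite !mxE /ea /ob /= !cast_ord_id.
have FE : F = dr_super (P *m D).
  rewrite D'E /dr_super block_mxKul block_mxKur block_mxKdl block_mxKdr.
  by congr block_mx; apply/matrixP => i j; rewrite !mxE /er /os /= !cast_ord_id.
have A'even : even_supermatrix part (A *m P').
  case: AE => /mxOverP E1 /mxOverP E2 /mxOverP E3 /mxOverP E4.
  rewrite A'E /even_supermatrix block_mxKul block_mxKur block_mxKdl block_mxKdr.
  by split; apply/mxOverP => i j; rewrite mxE.
rewrite XE in Xi *; rewrite FE in Fi *.
rewrite -(Ber_complement A'even A'D' Xi Fi) A'E Ber_col_perm //.
by rewrite !mulrA -signr_addb addbb mul1r.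
Qed.

End Superalgebra.

(** * Kept indices and rotations *)

(** Enumerations of sets of ordinals are increasing, so kept indices can be read off a filtered
    [iota]. *)
Lemma val_enum_filter m (A : {set 'I_m}) (P : pred nat) :
  (forall i : 'I_m, (i \in A) = P i) ->
  [seq val i | i <- enum A] = [seq i <- iota 0 m | P i].
Proof.
move=> AP; rewrite -val_enum_ord filter_map; congr map.
by rewrite /enum_mem filter_predT; apply: eq_filter => i; apply: AP.
Qed.

Lemma val_kept m k (A : {set 'I_m}) (h : #|~: A| = k) (i : 'I_k) :
  kept h i = nth 0%N [seq val i | i <- enum (~: A)] i :> nat.
Proof.
have ik : (i < size (enum (~: A)))%N by rewrite -cardE h.
by rewrite (nth_map (enum_default (cast_ord (esym h) i))).
Qed.

Lemma kept_last m k l (h : #|~: last_indices m k| = l) (i : 'I_l) :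
  kept h i = i :> nat.
Proof.
have il := ltn_ord i; rewrite -{2}h setC_last_indices card_first_indices ?leq_subr // in il.
rewrite val_kept (@val_enum_filter _ _ (fun i => i < m - k)%N); last first.
  by move=> j; rewrite setC_last_indices inE.
have -> := filter_iota_ltn 0 (leq_subr k m).
by rewrite nth_iota.
Qed.

Lemma kept_first m k l (h : #|~: first_indices m k| = l) (i : 'I_l) :
  kept h i = (k + i)%N :> nat.
Proof.
have il := ltn_ord i; rewrite -{2}h card_setC_first_indices in il.
rewrite val_kept (@val_enum_filter _ _ (fun i => k <= i)%N); last first.
  by move=> j; rewrite !inE -leqNgt.
(* If [k] exceeded [m], the truncated [m - k] would be 0 and there would be no index [i]. *)
have km : (k <= m)%N by rewrite leqNgt; apply: contraL il => /ltnW; rewrite -subn_eq0 => /eqP->.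
rewrite -[in iota 0 m](subnKC km) iotaD filter_cat add0n.
rewrite (_ : [seq _ <- iota 0 _ | _] = [::]); last first.
  by apply/eqP; rewrite -(negbK (_ == _)) -has_filter; apply/hasPn => j;
    rewrite mem_iota -ltnNge.
rewrite (_ : [seq _ <- iota k _ | _] = iota k (m - k)) ?nth_iota //.
by apply/all_filterP/allP => j; rewrite mem_iota => /andP[].
Qed.

(** The rotation is the [r]-th power of a [p]-cycle, whose parity is that of [p - 1], hence of
    [p + 1]. *)
Lemma rotation_perm p r : (0 < p)%N -> exists2 s : 'S_p,
  (forall i, s i = (i + r) %% p :> nat)%N & odd_perm s = odd (r * (p + 1)).
Proof.
(* [c] sends the last index to 0 and raises every other index by one. *)
case: p => // n _; pose c : 'S_n.+1 := lift_perm ord_max ord0 1.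
have cE i : c i = (i.+1 %% n.+1)%N :> nat.
  case: (unliftP ord_max i) => [j|] ->.
    by rewrite lift_perm_lift perm1 lift_max lift0 modn_small // ltnS.
  by rewrite lift_perm_id modnn.
exists (c ^+ r)%g.
  elim: r => [|r IH] i; first by rewrite perm1 addn0 modn_small.
  by rewrite expgSr permM cE IH -addn1 modnDml addn1 addnS.
have oc : odd_perm c = odd n by rewrite odd_lift_perm odd_perm1 /= !addbF.
have -> : odd_perm (c ^+ r)%g = odd r && odd n.
  elim: r => [|r IH]; first by rewrite odd_perm1.
  by rewrite expgS odd_permM IH oc /=; case: (odd r); case: (odd n).
by rewrite oddM addn1 /= negbK.
Qed.

(** For [i < m - k] the sum [i + k] stays below [m]: no wrap-around. *)
Lemma rotation_lshift m k (e : (m - k + k)%N = m) (s : 'S_m)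
    (h : #|~: first_indices m k| = (m - k)%N) :
  (forall i, s i = (i + k) %% m :> nat)%N ->
  s \o (cast_ord e \o lshift k) =1 kept h.
Proof.
move=> sE i; apply/val_inj; rewrite /= kept_first sE /= addnC modn_small //.
by rewrite -{2}e addnC ltn_add2r.
Qed.

(** The last [k] indices all wrap around: [m - k + i] goes to [m + i], that is, to [i]. *)
Lemma rotation_rshift m k (e : (m - k + k)%N = m) (s : 'S_m)
    (h : #|~: last_indices m (m - k)| = k) :
  (forall i, s i = (i + k) %% m :> nat)%N ->
  s \o (cast_ord e \o @rshift (m - k) k) =1 kept h.
Proof.
move=> sE i; apply/val_inj; rewrite /= kept_last sE /=.
have km : (k <= m)%N by rewrite -e leq_addl.
rewrite addnAC e addnC modnDr modn_small //.
exact: leq_trans (ltn_ord i) km.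
Qed.

Lemma lshift_kept m k (e : (m - k + k)%N = m)
    (h : #|~: last_indices m k| = (m - k)%N) :
  cast_ord e \o lshift k =1 kept h.
Proof. by move=> i; apply/val_inj; rewrite /= kept_last. Qed.

Lemma rshift_kept m k (e : (m - k + k)%N = m)
    (h : #|~: first_indices m (m - k)| = k) :
  cast_ord e \o @rshift (m - k) k =1 kept h.
Proof. by move=> i; apply/val_inj; rewrite /= kept_first. Qed.

(** * The complementary minor formula *)

Lemma scalars_two_neq0 (R : realType) (k : ground_field) :
  (2%:R : scalars R k) != 0.
Proof. by case: k; rewrite /= Num.Theory.pnatr_eq0. Qed.

Theorem theorem4p1 (R : realType) (k : ground_field)
    (SA : algType (scalars R k)) (part : bool -> {pred SA})
    (S_super : comm_superalgebra part)
    (p q r s : nat) (r_gt0 : (0 < r)%N) (r_lt_p : (r < p)%N)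
    (s_gt0 : (0 < s)%N) (s_lt_q : (s < q)%N)
    (A : 'M[SA]_(p + q)) (A_even : even_supermatrix part A)
    (A_inv : invertible A) :
  let u := last_super p q r s in
  let v := first_super p q r s in
  let u' := first_super p q (p - r) (q - s) in
  let v' := last_super p q (p - r) (q - s) in
  let Auv := @superdel SA p q (p - r) (q - s) (p - r) (q - s) u v
    (leaves_last p q r s) (leaves_first p q r s) A in
  let Bv'u' := @superdel SA p q r s r s v' u'
    (leaves_lastC r_lt_p s_lt_q) (leaves_firstC r_lt_p s_lt_q) (inverse A) in
  let t := (r * (p + 1) + s * (q + 1))%N in
  invertible Auv -> invertible Bv'u' ->
  Ber A * Ber Bv'u' = (-1) ^+ t * Ber Auv.
Proof.
move=> u v u' v' Auv Bvu t Xi Fi; have [D AD] := A_inv.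
have pE : (p - r + r)%N = p by rewrite subnK // ltnW.
have qE : (q - s + s)%N = q by rewrite subnK // ltnW.
have [sg sgE sg_odd] := rotation_perm r (ltn_trans r_gt0 r_lt_p).
have [tu tuE tu_odd] := rotation_perm s (ltn_trans s_gt0 s_lt_q).
have /= := Ber_rotated_complement (pE := pE) (qE := qE) (sg := sg) (tu := tu)
  S_super (scalars_two_neq0 R k) A_even AD.
have -> : (-1) ^+ t = (-1) ^+ (odd_perm sg (+) odd_perm tu) :> SA.
  by rewrite -signr_odd oddD sg_odd tu_odd.
set X := block_mx _ _ _ _; set F := block_mx _ _ _ _.
(* Only the columns of [Auv] and the rows of [Bvu] are rotated; the rows of [Auv] and the columns of
   [Bvu] are already in place. *)
have XE : Auv = X.
  rewrite /Auv /superdel; congr block_mx; apply: eq_mxsub => i;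
    apply/esym; first [exact: lshift_kept | exact: rotation_lshift].
have FE : Bvu = F.
  rewrite /Bvu /superdel (inverseP AD); congr block_mx; apply: eq_mxsub => i;
    apply/esym; first [exact: rshift_kept | exact: rotation_rshift].
by rewrite -XE -FE => ->.
Qed.
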